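(* Let $P^N\in\mathcal M^{np,N}$ be realizable under $(\mathcal Q_\beta,s)$. Suppose that $\mathcal B$ is a compact metric space, $\mathscr B$ is its Borel $\sigma$-field, and the maps $g$ and $\bar t^N_l$, $l=1,\dots,L^N$, are continuous on $\mathcal B$. Then for every $\psi\in[0,1]$: there exists a positive integer $K\le\tilde L^N+2$ with $D^N_K(P^N,\psi)=0$ if and only if $\psi\in\Psi^{\mathrm{mle},N}(P^N)$.
   Context: Write $[m]=\{1,\dots,m\}$, $\Delta_K=\{q\in[0,1]^K:\sum_kq_k=1\}$, and let $\Delta_{K\times L\times2}$ be the set of probability vectors on $[K]\times[L]\times[2]$. Conventions: $0\log(0/q)=0$, $r\log(r/0)=+\infty$ for $r>0$, $0\cdot\infty=0$, $\inf\varnothing=+\infty$; $\mathrm{KL}(r\|q)=\sum_xr(x)\log\frac{r(x)}{q(x)}$. Let $J,T\ge 1$ be integers and $\mathcal A_T=\{A_1\times\cdots\times A_T: \varnothing\neq A_t\subseteq[J]\}$. For an integer $N\ge1$ fix a design $a_1^N,\dots,a_N^N\in\mathcal A_T$, let $\mathcal Y^N=a_1^N\times\cdots\times a_N^N$ and let $\mathcal M^{np,N}$ be the set of all probability measures on the finite set $\mathcal Y^N$. Let $(\mathcal B,\mathscr B)$ be a measurable space and $\mathcal Q_\beta$ the set of all probability measures on it. A choice kernel is a measurable map $s:\mathcal B\times\mathcal A_T\times[J]^T\to[0,1]$ (discrete $\sigma$-algebras on the finite factors) with $s(\beta,a,y)=0$ if $y\notin a$ and $\sum_{y\in a}s(\beta,a,y)=1$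 for all $(\beta,a)$; fix one. For $Q_\beta\in\mathcal Q_\beta$, $P^{F,s,N}(Q_\beta)$ is the law of pairs $(\beta_i,Y_i)_{i\in[N]}$, independent across $i$, with $\beta_i\sim Q_\beta$ and $\mathbb P(Y_i=y\mid\beta_i)=s(\beta_i,a_i^N,y)$; $M_{\mathcal Y^N}$ maps such a law to the marginal law of $(Y_1,\dots,Y_N)$, so $M_{\mathcal Y^N}(P^{F,s,N}(Q_\beta))(y_1,\dots,y_N)=\prod_{i=1}^N\int_{\mathcal B} s(\beta,a_i^N,y_i)\,dQ_\beta(\beta)$. $P^N$ is realizable under $(\mathcal Q_\beta,s)$ if $P^N=M_{\mathcal Y^N}(P^{F,s,N}(Q_\beta))$ for some $Q_\beta\in\mathcal Q_\beta$. Let $g:\mathcal B\to[0,1]$ be measurable and $\tilde\Psi(Q_\beta)=\int g\,dQ_\beta$. Profile likelihood: $\mathrm{Risk}(P^N,Q_\beta)=-\sum_{y\in\mathcal Y^N}P^N(y)\log M_{\mathcal Y^N}(P^{F,s,N}(Q_\beta))(y)$, $\mathrm{PL}(P^N,\psi)=\inf\{\mathrm{Risk}(P^N,Q_\beta):Q_\beta\in\mathcal Q_\beta,\ \tilde\Psi(Q_\beta)=\psi\}$, and $\Psi^{\mathrm{mle},N}(P^N)$ is the set of minimizers of $\psi\mapsto\mathrm{PL}(P^N,\psi)$ over $[0,1]$. Moments: let $\mathcal D^N=\{(a,y):a\in\{a_1^N,\dots,a_N^N\},y\in a\}$, $n_a=\#\{i\in[N]:a_i^N=a\}$, $L^N=\#\mathcal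 D^N$, $(a(l),y(l))_{l\in[L^N]}$ an ordering of $\mathcal D^N$, $\bar t^N_l(\beta)=s(\beta,a(l),y(l))$, and $\bar b^N_l(P^N)=\frac1{n_{a(l)}}\sum_{i:a_i^N=a(l)}P^N_i(y(l))$ with $P^N_i$ the $i$-th marginal of $P^N$. $\tilde L^N+1$ is the maximal cardinality of a linearly independent subset of the functions $\{1,\bar t_1^N,\dots,\bar t^N_{L^N}\}$. Let $e_l^N=n_{a(l)}/N$, $\bar\alpha_l^N(P^N)=e_l^N\bar b_l^N(P^N)$, $\varpi_\psi(1)=\psi$, $\varpi_\psi(2)=1-\psi$, $\gamma(1,\beta)=g(\beta)$, $\gamma(2,\beta)=1-g(\beta)$. For a positive integer $K$, $$\mathcal R^{N,K}(P^N,\psi)=\Big\{r\in\Delta_{K\times L^N\times2}:\ \sum_{k=1}^K\sum_{m=1}^2r(k,l,m)=\bar\alpha^N_l(P^N)\ \forall l,\ \ \sum_{k=1}^K\sum_{l=1}^{L^N}r(k,l,m)=\varpi_\psi(m)\ \forall m\Big\},$$ $q^N_{w,\beta}(k,l,m)=w_k\,e_l^N\,\bar t_l^N(\beta_k)\,\gamma(m,\beta_k)$ for $w\in\Delta_K$, $\beta\in\mathcal B^K$, and $$D_K^N(P^N,\psi)=\inf_{w\in\Delta_K,\ \beta\in\mathcal B^K}\ \inf_{r\in\mathcal R^{N,K}(P^N,\psi)}\mathrm{KL}(r\|q^N_{w,\beta}).$$ *)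

(* Defs.v *)
From HB Require Import structures.
From mathcomp Require Export all_boot all_order all_algebra.
From mathcomp Require Export all_classical all_reals all_analysis.

Set Implicit Arguments.
Unset Strict Implicit.
Unset Printing Implicit Defensive.

Import Order.TTheory GRing.Theory Num.Theory.
Import numFieldNormedType.Exports.

Local Open Scope classical_set_scope.
Local Open Scope ring_scope.

(* Measurable types are pointed in the library, so a metric space carrying its
   Borel sigma-field has to be pointed as well. This excludes only the empty
   space, which carries no probability measure. *)
#[short(type="pointedMetricType")]
HB.structure Definition PointedMetric (K : numDomainType) :=
  {M of Pointed M & Metric K M}.

Notation borel T := (g_sigma_algebraType (@open T)).

Section Menus.
Variables J T : nat.

Definition outcome := {ffun 'I_T -> 'I_J}.

Definition is_menu : pred {set outcome} := fun a =>
  [exists A : {ffun 'I_T -> {set 'I_J}},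
    [forall t, A t != finset.set0] &&
    (a == [set y : outcome | [forall t, y t \in A t]]%SET)].

Definition menu := {a : {set outcome} | is_menu a}.

End Menus.

Section ChoiceKernel.
Variables (R : realType) (J T : nat) (d : measure_display).
Variable B : measurableType d.
Implicit Type s : B -> menu J T -> outcome J T -> R.

(* The product sigma-algebra of B with the discrete ones on the finite sets of
   menus and outcomes; the library's product needs pointed factors. *)
Definition kernel_sigma_algebra : set (set (B * menu J T * outcome J T)) :=
  <<s [set E | exists (X : set B) (M : set (menu J T)) (Y : set (outcome J T)),
         measurable X /\ E = X `*` M `*` Y] >>.

Definition choice_kernel s : Prop :=
  [/\ forall b a y, 0 <= s b a y <= 1,
      forall U : set R, measurable U ->
        kernel_sigma_algebra ((fun x => s x.1.1 x.1.2 x.2) @^-1` U),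
      forall b (a : menu J T) y, y \notin val a -> s b a y = 0
    & forall b (a : menu J T), \sum_(y in val a) s b a y = 1].

End ChoiceKernel.

Section Likelihood.
Variables (R : realType) (J T N : nat) (d : measure_display).
Variable B : measurableType d.
Variables (a : 'I_N -> menu J T) (s : B -> menu J T -> outcome J T -> R).
Variable g : B -> R.

Definition profile := {ffun 'I_N -> outcome J T}.

Definition profiles : {set profile} :=
  [set y : profile | [forall i, y i \in val (a i)]]%SET.

(* Probability measures on the finite set of profiles, as mass functions. *)
Definition nonparametric_model : set (profile -> R) :=
  [set P | [/\ forall y, 0 <= P y, forall y, y \notin profiles -> P y = 0
             & \sum_(y in profiles) P y = 1]].

(* The joint law of the independent pairs (beta_i, Y_i), given by its values on
   the boxes prod_i (A i * {y i}), which determine it. *)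
Definition full_law (Q : probability B R) (A : 'I_N -> set B) (y : profile) : R :=
  \prod_(i < N) \int[Q]_(b in A i) s b (a i) (y i).

(* Marginalizing beta_1, ..., beta_N out of a law given on boxes. *)
Definition outcome_marginal (F : ('I_N -> set B) -> profile -> R)
    (y : profile) : R :=
  F (fun=> setT) y.

Definition realizable (P : profile -> R) : Prop :=
  exists Q : probability B R,
    forall y, y \in profiles -> P y = outcome_marginal (full_law Q) y.

Definition Psi_tilde (Q : probability B R) : R := \int[Q]_b g b.

(* lne 0 = -oo and 0 * -oo = 0. *)
Definition risk (P : profile -> R) (Q : probability B R) : \bar R :=
  (- \sum_(y in profiles)
       (P y)%:E * lne (outcome_marginal (full_law Q) y)%:E)%E.

Definition profile_likelihood (P : profile -> R) (psi : R) : \bar R :=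
  ereal_inf [set risk P Q | Q in [set Q | Psi_tilde Q = psi]].

Definition Psi_mle (P : profile -> R) : set R :=
  [set psi | 0 <= psi <= 1 /\
     forall psi', 0 <= psi' <= 1 ->
       (profile_likelihood P psi <= profile_likelihood P psi')%E].

End Likelihood.

Section Moments.
Variables (R : realType) (J T N : nat) (d : measure_display).
Variable B : measurableType d.
Variables (a : 'I_N -> menu J T) (s : B -> menu J T -> outcome J T -> R).
Variable g : B -> R.

Definition menu_outcomes : {set menu J T * outcome J T} :=
  [set p : menu J T * outcome J T |
     [exists i, a i == p.1] && (p.2 \in val p.1)]%SET.

Definition menu_count (c : menu J T) : nat := #|[set i | a i == c]%SET|.

Local Notation L := #|menu_outcomes|.

Variable ay : 'I_L -> menu J T * outcome J T.

Definition is_ordering : Prop := injective ay /\ codom ay =i menu_outcomes.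

Definition tbar (l : 'I_L) (b : B) : R := s b (ay l).1 (ay l).2.

Definition coord_marginal (P : profile J T N -> R) (i : 'I_N)
    (y : outcome J T) : R :=
  \sum_(z in profiles a | z i == y) P z.

Definition bbar (P : profile J T N -> R) (l : 'I_L) : R :=
  (menu_count (ay l).1)%:R^-1 *
  \sum_(i | a i == (ay l).1) coord_marginal P i (ay l).2.

(* The functions 1, tbar_1, ..., tbar_L; the index None stands for 1. *)
Definition moment_family (o : option 'I_L) (b : B) : R :=
  if o is Some l then tbar l b else 1.

(* Independence of the subfamily indexed by S. It forces the functions indexed by
   S to be distinct, so #|S| counts functions. *)
Definition linearly_independent (S : {set option 'I_L}) : Prop :=
  forall c : option 'I_L -> R,
    (forall b, \sum_(o in S) c o * moment_family o b = 0) ->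
    forall o, o \in S -> c o = 0.

(* Ltilde + 1 is the maximum: the singleton of the constant 1 is independent, so
   the maximum is positive. *)
Definition Ltilde : nat :=
  (\max_(S : {set option 'I_L} | `[< linearly_independent S >]) #|S|).-1.

Definition simplex (I : finType) : set (I -> R) :=
  [set q | (forall i, 0 <= q i <= 1) /\ \sum_i q i = 1].

(* The case distinctions are the conventions 0 log (0 / q) = 0 and
   r log (r / 0) = +oo. *)
Definition KL (I : finType) (r q : I -> R) : \bar R :=
  (\sum_i (if r i == 0%R then 0
           else if q i == 0%R then +oo
           else (r i * ln (r i / q i))%:E))%E.

Definition eweight (l : 'I_L) : R := (menu_count (ay l).1)%:R / N%:R.

Definition alphabar (P : profile J T N -> R) (l : 'I_L) : R :=
  eweight l * bbar P l.

(* In 'I_2 the values 0 and 1 stand for m = 1 and m = 2. *)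
Definition varpi (psi : R) (m : 'I_2) : R := if m == ord0 then psi else 1 - psi.

Definition gamma (m : 'I_2) (b : B) : R := if m == ord0 then g b else 1 - g b.

Definition couplings (K : nat) (P : profile J T N -> R) (psi : R) :
    set ('I_K * 'I_L * 'I_2 -> R) :=
  [set r | [/\ simplex r,
    forall l, \sum_(k < K) \sum_(m < 2) r (k, l, m) = alphabar P l
  & forall m, \sum_(k < K) \sum_(l < L) r (k, l, m) = varpi psi m]].

Definition mixture (K : nat) (w : 'I_K -> R) (b : 'I_K -> B)
    (x : 'I_K * 'I_L * 'I_2) : R :=
  let: (k, l, m) := x in w k * eweight l * tbar l (b k) * gamma m (b k).

Definition divergence (K : nat) (P : profile J T N -> R) (psi : R) : \bar R :=
  ereal_inf [set ereal_inf [set KL r (mixture wb.1 wb.2)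
                           | r in couplings (K := K) P psi]
            | wb in [set wb : ('I_K -> R) * ('I_K -> B) | simplex wb.1]].

End Moments.

(* Main.v *)
(* A law with outcome marginal P exists, so by Gibbs' inequality the profile
   likelihood is bounded below by the entropy of P, and psi minimizes it iff
   that bound is the infimum over the Q with [int g dQ = psi]. A quantitative
   form of Gibbs' inequality turns near-minimizers into Q whose moments are
   close to those of P. Cutting such a Q into level sets and applying
   Caratheodory's theorem to the cone generated by the values of
   (g, 1, tbar_1, ..., tbar_L), whose span has dimension at most Ltilde + 2,
   gives mixtures of Ltilde + 2 points with almost the right moments;
   compactness makes the moments exact. Conversely, the divergence of r from a
   mixture q is small only if r and q are l1-close, so by the same compactness a
   vanishing infimum means that some mixture of K points has exactly the moments
   of P and effect psi. *)
Require Import Defs.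
From mathcomp Require Import ring lra measurable_realfun.
Set Implicit Arguments.
Unset Strict Implicit.
Unset Printing Implicit Defensive.
Import Order.TTheory GRing.Theory Num.Theory.
Import numFieldNormedType.Exports.
Local Open Scope classical_set_scope.
Local Open Scope ring_scope.

(** * Quantitative Gibbs inequality *)

(** With [x] and [y] the square roots of [p] and [q], the bound [ln u <= u - 1] at [u = y / x] gives
    [p * ln (p / q) >= 2 * (p - x * y) = p - q + (x - y) ^+ 2]. The last square dominates
    [(p - q) ^+ 2 / 4] because [x + y <= 2]. *)
Lemma xlnx_div_ge (R : realType) (p q : R) : 0 < p <= 1 -> 0 < q <= 1 ->
  p - q + (p - q) ^+ 2 / 4 <= p * ln (p / q).
Proof.
move=> /andP[p0 p1] /andP[q0 q1].
set x := Num.sqrt p; set y := Num.sqrt q.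
have x0 : 0 < x by rewrite sqrtr_gt0.
have y0 : 0 < y by rewrite sqrtr_gt0.
have xE : p = x ^+ 2 by rewrite sqr_sqrtr// ltW.
have yE : q = y ^+ 2 by rewrite sqr_sqrtr// ltW.
have x1 : x <= 1 by rewrite -sqrtr1 ler_sqrt.
have y1 : y <= 1 by rewrite -sqrtr1 ler_sqrt.
have lnyx : ln (y / x) <= y / x - 1.
  have yx0 : 0 < y / x by rewrite divr_gt0.
  have := @le_ln1Dx R (y / x - 1).
  by rewrite [1 + _]addrC subrK; apply; lra.
have -> : ln (p / q) = - (2 * ln (y / x)).
  have -> : p / q = ((y / x) ^+ 2)^-1.
    by rewrite xE yE; field; rewrite !gt_eqF.
  rewrite lnV; last by rewrite posrE exprn_gt0// divr_gt0.
  by rewrite lnXn ?divr_gt0// mulr_natl.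
have h : p * ln (y / x) <= x * y - p.
  have -> : x * y - p = p * (y / x - 1).
    by rewrite xE; field; rewrite gt_eqF.
  by rewrite ler_wpM2l// ltW.
have h2 : (p - q) ^+ 2 / 4 <= (x - y) ^+ 2.
  have -> : (p - q) ^+ 2 / 4 = (x - y) ^+ 2 * ((x + y) ^+ 2 / 4).
    by rewrite xE yE; field.
  by rewrite ler_piMr ?sqr_ge0//; nra.
rewrite mulrN lerNr mulrCA; move: h h2; rewrite (sqrrB x y) -xE -yE; lra.
Qed.

(** The previous bound in the shape of one risk term, extended to zero masses: at [p = 0] it amounts
    to [0 <= q - q ^+ 2 / 4], and at [q = 0 < p] the left side is [-oo]. *)
Lemma mul_lne_le (R : realType) (p q : R) : 0 <= p <= 1 -> 0 <= q <= 1 ->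
  (p%:E * lne q%:E <= (p * ln p + q - p - (p - q) ^+ 2 / 4)%:E)%E.
Proof.
move=> /andP[p0 p1] /andP[q0 q1].
have [->|pn0] := eqVneq p 0.
  rewrite mul0e lee_fin; nra.
have {p0}p0 : 0 < p by rewrite lt_neqAle eq_sym pn0.
have [->|qn0] := eqVneq q 0.
  by rewrite le0_lneNy// gt0_muleNy ?lte_fin// leNye.
have {q0}q0 : 0 < q by rewrite lt_neqAle eq_sym qn0.
rewrite lne_EFin// -EFinM lee_fin.
have := @xlnx_div_ge R p q; rewrite p0 p1 q0 q1 => /(_ isT isT).
by rewrite ln_div ?posrE// mulrBr; lra.
Qed.

(** The differences [r i - q i] sum to zero, so they can be added freely and the scalar bound
    applied term by term. *)
Lemma KL_ge (R : realType) (I : finType) (r q : I -> R) :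
  simplex r -> simplex q ->
  ((\sum_i (r i - q i) ^+ 2 / 4)%:E <= KL r q)%E.
Proof.
move=> [r01 r1] [q01 q1].
have -> : \sum_i (r i - q i) ^+ 2 / 4 =
    \sum_i (r i - q i + (r i - q i) ^+ 2 / 4).
  by rewrite big_split/= sumrB r1 q1 subrr add0r.
rewrite -sumEFin; apply: lee_sum => i _.
have /andP[r0 rle1] := r01 i; have /andP[q0 qle1] := q01 i.
case: (eqVneq (r i) 0) => [->|rn0]; first by rewrite lee_fin; nra.
case: (eqVneq (q i) 0) => [_|qn0]; first by rewrite leey.
by rewrite lee_fin xlnx_div_ge ?rle1 ?qle1 ?andbT// lt_neqAle eq_sym ?rn0 ?qn0.
Qed.

Lemma sqr_dist_l1_small (R : realType) (I : finType) (A : pred I) (e : R) :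
  0 < e ->
  exists2 d : R, 0 < d & forall r q : I -> R,
    \sum_(i | A i) (r i - q i) ^+ 2 / 4 < d -> \sum_(i | A i) `|r i - q i| < e.
Proof.
move=> e0; set n : R := #|A|%:R + 1.
have n0 : 0 < n by rewrite /n addrC ltr_pwDl.
have c0 : 0 < e / n by rewrite divr_gt0.
(* With this choice each [|r i - q i|] is at most [e / n]; since [n] exceeds [#|A|], the sum stays
   strictly below [e], even for empty [A]. *)
exists ((e / n) ^+ 2 / 4); first by rewrite divr_gt0// exprn_gt0.
move=> r q rq.
apply: (@le_lt_trans _ _ (\sum_(i | A i) e / n)).
  apply: ler_sum => i Ai; rewrite -(@ler_pXn2r _ 2) ?nnegrE// ?ltW//.
  rewrite -normrX ger0_norm ?sqr_ge0//.
  have : (r i - q i) ^+ 2 / 4 <= \sum_(i | A i) (r i - q i) ^+ 2 / 4.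
    rewrite (bigD1 i)//= lerDl sumr_ge0// => j _.
    by rewrite divr_ge0// sqr_ge0.
  lra.
rewrite sumr_const -mulr_natl mulrA ltr_pdivrMr// mulrC ltr_pM2l//.
by rewrite /n ltrDl.
Qed.

(** * Caratheodory reduction in cones *)

(* Moving the weights along a linear relation until the first one vanishes. *)
Lemma conic_relation_drop (R : realType) (n : nat) (w c : 'I_n.+1 -> R) :
  (forall k, 0 <= w k) -> (exists k, c k != 0) ->
  exists (k0 : 'I_n.+1) (t : R),
    w k0 + t * c k0 = 0 /\ forall k, 0 <= w k + t * c k.
Proof.
move=> w0; wlog [k ck] : c / exists k, 0 < c k.
  move=> H [k ck]; have [ckp|ckn] := ltP 0 (c k).
    by apply: H; exists k.
  have cNk : 0 < - c k by rewrite oppr_gt0 lt_neqAle ck.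
  have [||k0 [t [tk0 tk]]] := H (fun k => - c k).
  - by exists k.
  - by exists k; rewrite oppr_eq0.
  exists k0, (- t); split; first by rewrite mulNr -mulrN.
  by move=> j; rewrite mulNr -mulrN.
move=> _.
(* The smallest ratio [w / c] among positive [c] marks the first weight to reach zero; indices with
   [c <= 0] only gain weight. *)
pose k0 := [arg min_(i < k | 0 < c i) (w i / c i)]%O.
have [ck0 kmin] : 0 < c k0 /\ forall j, 0 < c j -> w k0 / c k0 <= w j / c j.
  by rewrite /k0; case: Order.TotalTheory.arg_minP.
exists k0, (- (w k0 / c k0)); split.
  by rewrite mulNr divfK ?subrr// gt_eqF.
move=> j; rewrite mulNr subr_ge0.
have [cj|cj] := ltP 0 (c j).
  by rewrite -ler_pdivlMr// kmin.
apply: le_trans (w0 j); rewrite -oppr_ge0 -mulrN mulr_ge0 ?oppr_ge0//.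
by rewrite divr_ge0// ltW.
Qed.

(** Induction on the number of points: more than [K] of them make the rows of the evaluation matrix
    dependent, and moving along the dependency removes a point without changing any moment. *)
Lemma conic_caratheodory (R : realType) (I : finType) (B : pointedType)
    (f : I -> B -> R) (K : nat) :
  (forall n (b : 'I_n -> B), (\rank (\matrix_(k < n, i < #|I|)
       f (enum_val i) (b k)) <= K)%N) ->
  forall n (w : 'I_n -> R) (b : 'I_n -> B), (forall k, 0 <= w k) ->
  exists (w' : 'I_K -> R) (b' : 'I_K -> B), (forall k, 0 <= w' k) /\
    forall i, \sum_k w' k * f i (b' k) = \sum_k w k * f i (b k).
Proof.
move=> fK; elim=> [|n IH] w b w0.
  exists (fun=> 0), (fun=> point); split=> // i.
  by rewrite big_ord0 big1// => k _; rewrite mul0r.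
have [nK|Kn] := leqP n.+1 K.
  (* At most [K] points are padded to exactly [K] by zero weights at [point]. *)
  exists (fun k => if insub (val k) is Some j then w j else 0).
  exists (fun k => if insub (val k) is Some j then b j else point).
  split=> [k|i]; first by case: insubP.
  have -> : \sum_k w k * f i (b k) =
      \sum_(k < n.+1) w (inord k) * f i (b (inord k)).
    by apply: eq_bigr => k _; rewrite inord_val.
  rewrite (big_ord_widen K (fun k => w (inord k) * f i (b (inord k))))//.
  rewrite [RHS]big_mkcond/=; apply: eq_bigr => k _.
  case: insubP => [j kn jk|/negbTE ->]; last by rewrite mul0r.
  by rewrite kn -jk inord_val.
pose M := \matrix_(k < n.+1, i < #|I|) f (enum_val i) (b k).
have /matrix0Pn [i0 [j0 cn0]] : kermx M != 0.
  rewrite -mxrank_eq0 mxrank_ker subn_eq0 -ltnNge.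
  exact: leq_ltn_trans (fK _ _) Kn.
pose c k := kermx M i0 k.
have cM i : \sum_k c k * f i (b k) = 0.
  have /matrixP/(_ i0 (enum_rank i)) := mulmx_ker M.
  rewrite mxE [RHS]mxE => H; apply: etrans H; apply: eq_bigr => k _.
  by rewrite [M _ _]mxE enum_rankK.
have [|k0 [t [tk0 tk]]] := conic_relation_drop w0 (c := c); first by exists j0.
have [|w' [b' [w'0 w'E]]] :=
  IH (fun k => w (lift k0 k) + t * c (lift k0 k)) (fun k => b (lift k0 k)).
  by move=> k.
exists w', b'; split=> // i; rewrite w'E.
transitivity (\sum_k (w k + t * c k) * f i (b k)).
  by rewrite (bigD1_ord k0)//= tk0 mul0r add0r.
under eq_bigr => k _ do rewrite mulrDl -mulrA.
by rewrite big_split/= -mulr_sumr cM mulr0 addr0.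
Qed.

(** * From approximate to exact moments by compactness *)

Section ExactFromApproximate.
Import ArrowAsProduct.

(** The total moment error is continuous on the compact set of [K]-tuples in [[0, 1] * B], so it has
    a minimum there, and approximability pushes this minimum below every positive number. *)
Lemma mixture_moments_attained (R : realType) (B : topologicalType)
    (I : finType) (K : nat) (f : I -> B -> R) (v : I -> R) :
  compact [set: B] -> (forall i, continuous (f i)) ->
  (forall e : R, 0 < e -> exists (w : 'I_K -> R) (b : 'I_K -> B),
     (forall k, 0 <= w k <= 1) /\
     forall i, `|\sum_k w k * f i (b k) - v i| < e) ->
  exists (w : 'I_K -> R) (b : 'I_K -> B),
     (forall k, 0 <= w k <= 1) /\ forall i, \sum_k w k * f i (b k) = v i.
Proof.
move=> cB cf approx.
pose T : topologicalType := prod_topology (fun _ : 'I_K => (R * B)%type).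
pose F (x : T) := \sum_i `|\sum_k (x k).1 * f i (x k).2 - v i|.
pose A := [set x : T | forall k, (`[0, 1]%classic `*` [set: B]) (x k)].
have cA : compact A.
  apply: (@tychonoff _ (fun _ : 'I_K => (R * B)%type : topologicalType)
    (fun=> `[0, 1]%classic `*` [set: B])) => k.
  by apply: compact_setX => //; exact: segment_compact.
have A0 : A !=set0.
  have [w [b [w01 _]]] := approx 1 ltr01.
  by exists (fun k => (w k, b k)) => k; split => //=; rewrite in_itv/= w01.
have pc k : continuous (fun x : T => x k).
  exact: (@proj_continuous _ (fun _ : 'I_K => (R * B)%type : topologicalType)).
have Fc : continuous F.
  have gen (X : topologicalType) (p : 'I_K -> X -> R) (q : 'I_K -> X -> B) :
      (forall k, continuous (p k)) -> (forall k, continuous (q k)) ->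
      continuous (fun x => \sum_i `|\sum_k p k x * f i (q k x) - v i|).
    move=> cp cq; apply: continuous_big => [|i _ x].
      exact: add_continuous.
    apply: cvg_norm; apply: cvgB; last exact: cvg_cst.
    apply: cvg_big => [|k _]; first exact: add_continuous.
    by apply: cvgM; [exact: cp|apply: (cvg_comp _ _ (cq k x)); exact: cf].
  apply: (gen T (fun k x => (x k).1) (fun k x => (x k).2)) => k x.
    by apply: (cvg_comp _ _ (pc k x)); exact: cvg_fst.
  by apply: (cvg_comp _ _ (pc k x)); exact: cvg_snd.
have [x xA xmin] := compact_EVT_min A0 cA (continuous_subspaceT Fc).
have F0 : F x = 0.
  apply/eqP; rewrite eq_le sumr_ge0 ?andbT; last by move=> i _.
  apply/ler_addgt0Pl => e e0; rewrite addr0.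
  (* The error [e] is shared among the indices; the [+ 1] keeps the divisor positive for empty
     [I]. *)
  have e'0 : 0 < e / (#|I|%:R + 1) by rewrite divr_gt0// addrC ltr_pwDl.
  have [w [b [w01 wb]]] := approx _ e'0.
  have yA : ((fun k => (w k, b k)) : T) \in A.
    by rewrite inE => k; split => //=; rewrite in_itv/= w01.
  apply: le_trans (xmin _ yA) _.
  apply: (@le_trans _ _ (\sum_(i : I) e / (#|I|%:R + 1))).
    by apply: ler_sum => i _; exact: ltW.
  rewrite sumr_const -[leLHS]mulr_natl mulrA ler_pdivrMr; last first.
    by rewrite addrC ltr_pwDl.
  by rewrite mulrC ler_pM2l// lerDl.
exists (fun k => (x k).1), (fun k => (x k).2); split.
  by move=> k; move: xA; rewrite inE => /(_ k)[] /=; rewrite in_itv.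
move=> i; apply/eqP; rewrite -subr_eq0 -normr_eq0.
move/eqP: F0; rewrite psumr_eq0// => /allP/(_ i).
by rewrite mem_index_enum => /(_ isT).
Qed.

End ExactFromApproximate.

(** * Probability measures and finite mixtures *)

Lemma bounded01_integrable d (T : measurableType d) (R : realType)
    (Q : probability T R) (f : T -> R) :
  measurable_fun setT f -> (forall b, 0 <= f b <= 1) ->
  Q.-integrable setT (EFin \o f).
Proof.
move=> mf f01; apply: measurable_bounded_integrable => //.
  by apply: le_lt_trans (ltry 1); exact: probability_le1.
exists 1; split=> // c c1 b _ /=; apply: le_trans (ltW c1).
by have /andP[f0 f1] := f01 b; rewrite ger0_norm.
Qed.

Lemma Rintegral_sum d (T : measurableType d) (R : realType)
    (mu : {measure set T -> \bar R}) (I : finType) (A : pred I)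
    (f : I -> T -> R) :
  (forall i, mu.-integrable setT (EFin \o f i)) ->
  \int[mu]_x (\sum_(i | A i) f i x) = \sum_(i | A i) \int[mu]_x f i x.
Proof.
move=> fi; rewrite /Rintegral.
under eq_integral => x _ do rewrite -sumEFin.
rewrite integral_sum//.
rewrite sum_fine// => i _.
by have := integrable_fin_num measurableT (fi i).
Qed.

Lemma Rintegral_indic d (T : measurableType d) (R : realType)
    (Q : probability T R) (A : set T) : measurable A ->
  \int[Q]_x \1_A x = fine (Q A).
Proof. by move=> mA; rewrite /Rintegral integral_indic// setIT. Qed.

(* The pieces of the partition are the level sets of the digits of
   [(M.+1 * f i)_i]; on each of them every [f i] varies by less than
   [1 / M.+1]. *)
Lemma integral_approx_mixture d (T : measurableType d) (R : realType)
    (Q : probability T R) (I : finType) (f : I -> T -> R) (e : R) :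
  (forall i, measurable_fun setT (f i)) ->
  (forall i b, 0 <= f i b <= 1) -> 0 < e ->
  exists n (w : 'I_n -> R) (b : 'I_n -> T), [/\ forall k, 0 <= w k,
    \sum_k w k = 1 & forall i, `|\sum_k w k * f i (b k) - \int[Q]_x f i x| < e].
Proof.
move=> mf f01 e0.
pose M := Num.truncn e^-1.
have Me : M.+1%:R^-1 < e.
  rewrite -[ltRHS]invrK ltf_pV2 ?posrE ?invr_gt0//.
  exact: truncnS_gt.
(* Digits run from [0] to [M.+1] included, because the value [1] of [f i] has digit [M.+1]. *)
pose V := {ffun I -> 'I_M.+2}.
pose A (v : V) : set T := \bigcap_(i in [set: I])
  (f i @^-1` `[(v i)%:R / M.+1%:R, (v i).+1%:R / M.+1%:R[%classic).
have mA v : measurable (A v).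
  apply: fin_bigcap_measurable => // i _.
  by rewrite -[X in measurable X]setTI; exact: mf.
have AP v b : A v b -> forall i,
    (v i)%:R <= M.+1%:R * f i b /\ M.+1%:R * f i b < (v i).+1%:R.
  move=> Avb i; have := Avb i Logic.I; rewrite /= in_itv/= => /andP[].
  by rewrite ler_pdivrMr// ltr_pdivlMr// mulrC.
pose phi (b : T) : V := [ffun i => inord (Num.truncn (M.+1%:R * f i b))].
have Aphi b : A (phi b) b.
  move=> i _; have /andP[f0 f1] := f01 i b.
  have Mf0 : 0 <= M.+1%:R * f i b by rewrite mulr_ge0.
  rewrite /= in_itv/= ler_pdivrMr// ltr_pdivlMr// mulrC ffunE.
  rewrite inordK; last first.
    rewrite ltnS truncn_le_nat (@le_lt_trans _ _ M.+1%:R)//.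
      by rewrite ler_piMr.
    by rewrite ltr_nat.
  by rewrite truncn_le Mf0 truncnS_gt.
have Auniq v b : A v b -> v = phi b.
  move=> Avb; apply/ffunP => i; apply/val_inj.
  have [h1 h2] := AP _ _ Avb i; have [h3 h4] := AP _ _ (Aphi b) i.
  apply/eqP; rewrite eqn_leq -!(ltnS (val _)) -!(ltr_nat R).
  by rewrite (le_lt_trans h1 h4) (le_lt_trans h3 h2).
(* An empty cell gets the default [point], which is harmless since its mass is zero. *)
pose pt v := xget point (A v).
(* Freezing [f i] at the sample point of each cell gives a step function whose integral is exactly
   the mixture moment. *)
pose h i b := \sum_v f i (pt v) * \1_(A v) b.
have hE i b : h i b = f i (pt (phi b)).
  rewrite /h (bigD1 (phi b))//= indicE mem_set// mulr1 big1 ?addr0// => v vb.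
  rewrite indicE memNset ?mulr0// => Avb.
  by move/eqP: vb; apply; exact: Auniq.
have fh i b : `|h i b - f i b| <= M.+1%:R^-1.
  have Apt : A (phi b) (pt (phi b)) by apply: xgetPex; exists b.
  have [h1 h2] := AP _ _ Apt i; have [h3 h4] := AP _ _ (Aphi b) i.
  rewrite hE -(@ler_pM2l _ M.+1%:R)// divff// -[X in X * _]ger0_norm//.
  rewrite -normrM mulrBr ler_norml.
  have E : (phi b i).+1%:R = (phi b i)%:R + 1 :> R by rewrite -addn1 natrD.
  by rewrite E in h2 h4; lra.
have indici v : Q.-integrable setT (EFin \o \1_(A v)).
  exact: integrable_indic.
have cint (c : V -> R) v :
    Q.-integrable setT (EFin \o (fun b => c v * \1_(A v) b)).
  have -> : EFin \o (fun b => c v * \1_(A v) b) =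
      (fun b => (c v)%:E * (EFin \o \1_(A v)) b)%E.
    by apply/funext => b /=; rewrite EFinM.
  exact: integrableZl.
have hi i : Q.-integrable setT (EFin \o h i).
  have -> : EFin \o h i =
      (fun b => \sum_v (EFin \o (fun b => (f i (pt v) * \1_(A v) b)%R)) b)%E.
    by apply/funext => b /=; rewrite sumEFin.
  by apply: integrable_sum => // v _; exact: (cint (fun v => f i (pt v))).
pose ev (k : 'I_#|V|) : V := enum_val k.
have sumE (c : V -> R) : \sum_k fine (Q (A (ev k))) * c (ev k) =
    \int[Q]_x (\sum_v c v * \1_(A v) x).
  rewrite Rintegral_sum; last exact: cint.
  rewrite (reindex _ (onW_bij _ (enum_rank_bij V)))/=.
  apply: eq_bigr => v _; rewrite /ev enum_rankK.
  by rewrite RintegralZl// Rintegral_indic// mulrC.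
have Q1 : fine (Q setT) = 1 by rewrite probability_setT.
exists #|V|, (fun k => fine (Q (A (ev k)))), (fun k => pt (ev k)).
split=> [k||i]; first by rewrite fine_ge0.
  under eq_bigr => k _ do rewrite -[fine _]mulr1.
  rewrite (sumE (fun=> 1)); transitivity (\int[Q]_(x in setT) (1 : R)).
    apply: eq_Rintegral => b _.
    rewrite (bigD1 (phi b))//= indicE mem_set// mul1r.
    rewrite big1 ?addr0// => v vb; rewrite indicE memNset ?mulr0// => Avb.
    by move/eqP: vb; apply; exact: Auniq.
  by rewrite Rintegral_cst// Q1 mulr1.
rewrite (sumE (fun v => f i (pt v))) -[X in X - _]/(\int[Q]_x h i x).
have fi : Q.-integrable setT (EFin \o f i) by exact: bounded01_integrable.
rewrite -RintegralB//; apply: le_lt_trans Me.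
have hfi : Q.-integrable setT (EFin \o (fun b => h i b - f i b)).
  have -> : EFin \o (fun b => h i b - f i b) =
    ((EFin \o h i) \- (EFin \o f i))%E by [].
  exact: integrableB.
apply: (le_trans (le_normr_Rintegral _ _)) => //.
apply: (@le_trans _ _ (\int[Q]_(b in setT) (M.+1%:R^-1))).
  apply: le_Rintegral => //.
  - exact: integrable_norm.
  - by apply: finite_measure_integrable_cst.
by rewrite Rintegral_cst// Q1 mulr1.
Qed.
Lemma mixture_probability d (T : measurableType d) (R : realType) (K : nat)
    (w : 'I_K -> R) (b : 'I_K -> T) :
  (forall k, 0 <= w k) -> \sum_k w k = 1 ->
  exists Q : probability T R, forall f : T -> R,
    measurable_fun setT f -> (forall x, 0 <= f x) ->
    \int[Q]_x f x = \sum_k w k * f (b k).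
Proof.
move=> w0 w1.
(* The sum of measures is indexed by [nat]; indices from [K] on get weight [0] at [point] and are
   never summed. *)
pose W (j : nat) : {nonneg R} :=
  if insub j is Some k then NngNum (w0 k) else NngNum (lexx (0 : R)).
pose p (j : nat) : T := if insub j is Some k then b k else point.
pose mj (j : nat) : {measure set T -> \bar R} := mscale (W j) (dirac (p j)).
pose mu : {measure set T -> \bar R} := msum mj K.
have WE (k : 'I_K) : (W k)%:num = w k by rewrite /W valK.
have pE (k : 'I_K) : p k = b k by rewrite /p valK.
have int (f : T -> R) : measurable_fun setT f -> (forall x, 0 <= f x) ->
    (\int[mu]_x (f x)%:E = \sum_k (w k * f (b k))%:E)%E.
  move=> mf f0; have /measurable_EFinP mEf := mf.
  have Ef0 x : [set: T] x -> (0 <= (f x)%:E)%E by rewrite lee_fin.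
  rewrite ge0_integral_measure_sum//.
  apply: eq_bigr => k _; rewrite ge0_integral_mscale//.
  by rewrite integral_dirac// diracT mul1e WE pE.
have mu1 : mu setT = 1%E.
  rewrite /mu /= /msum -[RHS]/(1%:E) -w1 -sumEFin; apply: eq_bigr => k _.
  by rewrite /= /mscale /= diracT mule1 WE.
(* The mass of [mu] is already [1], so normalizing changes no value and only supplies the structure
   of a probability. *)
pose Q : probability T R := mnormalize mu (dirac point).
have QE A : Q A = mu A.
  by rewrite /Q /= /mnormalize mu1 /= onee_eq0/= invr1 mule1.
exists Q => f mf f0.
rewrite /Rintegral (eq_measure_integral mu); last by move=> A _ _; exact: QE.
by rewrite int// sumEFin.
Qed.

Lemma continuous_borel_measurable (R : realType) (B : pointedMetricType R)
    (f : B -> R) :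
  continuous f -> measurable_fun [set: borel B] (f : borel B -> R).
Proof.
move=> /continuousP cf; apply: (measurability _ (RGenOpens.measurableE R)).
move=> _ [_ [x [y ->] <-]]; rewrite setTI.
by apply: sub_sigma_algebra; exact/cf/interval_open.
Qed.

(** * Rank of evaluation matrices *)

(** Take a maximal independent set of columns and discard the extra function [None], losing at most
    one. A relation on all of [B] between the remaining functions holds in particular at the points
    [b k], hence between independent columns, so it is trivial. *)
Lemma rank_le_independent (R : realType) (X : finType) (B : Type)
    (F : option X -> B -> R) (D : nat) :
  (forall S : {set X},
     (forall c : X -> R, (forall b, \sum_(o in S) c o * F (Some o) b = 0) ->
        forall o, o \in S -> c o = 0) -> (#|S| <= D)%N) ->
  forall n (b : 'I_n -> B),
    (\rank (\matrix_(k < n, i < #|{: option X}|)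
       F (enum_val i) (b k)) <= D.+1)%N.
Proof.
move=> indep n b; set M := \matrix_(_, _) _.
rewrite -mxrank_tr; set r := \rank _.
pose ev (j : 'I_r) : option X := enum_val (maxrankfun M^T j).
have ev_inj : injective ev.
  by move=> i j /enum_val_inj; exact: maxrankfun_inj.
pose A := [set ev j | j : 'I_r]%SET.
pose S := (Some @^-1: A)%SET.
have rS : (r <= #|S|.+1)%N.
  have -> : r = #|A| by rewrite card_imset// card_ord.
  have -> : #|S| = #|(Some @: S)%SET| by rewrite card_imset// => ? ? [].
  rewrite -add1n -(cards1 (@None X)); apply: leq_trans (leq_card_setU _ _).
  apply: subset_leq_card; apply/fintype.subsetP => -[x|] xA; last first.
    by rewrite !inE.
  by rewrite !inE/= mem_imset ?inE// => ? ? [].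
apply: leq_trans rS _; rewrite ltnS; apply: indep => c c0.
pose c' (i : option X) := if i is Some o then c o else 0.
pose u := \row_(j < r) c' (ev j).
have u0 : u = 0.
  (* Independent rows have a right inverse, so a vanishing combination of them has zero
     coefficients. *)
  have /row_freeP[N MN] : row_free (rowsub (maxrankfun M^T) M^T).
    by exact: maxrowsub_free.
  rewrite -[u]mulmx1 -MN mulmxA.
  suff -> : u *m rowsub (maxrankfun M^T) M^T = 0 by rewrite mul0mx.
  apply/rowP => k; rewrite !mxE.
  transitivity (\sum_(i in A) c' i * F i (b k)).
    rewrite big_imset/=; last by move=> ? ? _ _; exact: ev_inj.
    by apply: eq_bigr => j _; rewrite !mxE.
  rewrite -[RHS](c0 (b k)) (bigID (pred1 None))/= big1 ?add0r; last first.
    by move=> i /andP[_ /eqP ->]; rewrite mul0r.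
  rewrite (eq_bigl (mem (Some @: S)%SET)); last first.
    move=> [x|] /=; last first.
      by rewrite andbF; apply/esym/negbTE/imsetP => -[].
    by rewrite andbT mem_imset ?inE// => ? ? [].
  by rewrite big_imset//= => ? ? _ _ [].
move=> o; rewrite inE => /imsetP[j _ jE].
by have /rowP/(_ j) := u0; rewrite !mxE -jE.
Qed.

(** * Product laws on profiles *)

Section ProductLaw.
Variables (R : realType) (J T N : nat) (a : 'I_N -> menu J T).
Variable c : 'I_N -> outcome J T -> R.
Hypothesis c1 : forall i, \sum_(y in val (a i)) c i y = 1.

Lemma product_law_sum : \sum_(z in profiles a) \prod_i c i (z i) = 1.
Proof.
transitivity (\prod_i \sum_(y in val (a i)) c i y); last first.
  by rewrite big1.
rewrite bigA_distr_big_dep/=; apply: eq_bigl => z.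
by rewrite /profiles inE; apply/forallP/familyP => za i; have := za i.
Qed.

(** The constraint [z i == y] moves into the range of the [i]-th factor; after distributing, that
    factor is [c i y] and all others sum to [1]. *)
Lemma product_law_marginal i y : y \in val (a i) ->
  \sum_(z in profiles a | z i == y) \prod_j c j (z j) = c i y.
Proof.
move=> yi.
transitivity (\prod_j \sum_(x in val (a j) | (j == i) ==> (x == y)) c j x).
  rewrite bigA_distr_big_dep/=; apply: eq_bigl => z; rewrite /profiles inE.
  apply/andP/familyP => [[/forallP za /eqP zy] j|za].
    by apply/andP; split; [exact: za|apply/implyP => /eqP ->; rewrite zy].
  split; first by apply/forallP => j; have /andP[] := za j.
  by have /andP[_ /implyP] := za i; apply.
rewrite (bigD1 i)//= [X in _ * X]big1 ?mulr1; last first.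
  move=> j /negbTE ji; rewrite -[RHS](c1 j); apply: eq_bigl => x.
  by rewrite ji andbT.
rewrite (big_pred1 y)// => x; rewrite eqxx/=.
by case: eqP => [->|]; rewrite ?yi// andbF.
Qed.

End ProductLaw.

(** * Choice probabilities, moments and risk *)

Section Model.
Variables (R : realType) (J T N : nat) (d : measure_display).
Variable B : measurableType d.
Variables (a : 'I_N -> menu J T) (s : B -> menu J T -> outcome J T -> R).
Variable ay : 'I_#|menu_outcomes a| -> menu J T * outcome J T.
Hypothesis hs : choice_kernel s.
Hypothesis hay : is_ordering ay.
Hypothesis htm : forall l, measurable_fun [set: B] (tbar s ay l).

Local Notation law Q := (outcome_marginal (full_law a s Q)).

Lemma ordering_mem l :
  (exists i, a i = (ay l).1) /\ (ay l).2 \in val (ay l).1.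
Proof.
have [_ ayE] := hay; have : ay l \in menu_outcomes a by rewrite -ayE codom_f.
by rewrite inE => /andP[/existsP[i /eqP ai] yl]; split => //; exists i.
Qed.

Lemma ordering_onto i y : y \in val (a i) -> exists l, ay l = (a i, y).
Proof.
move=> yi; have [_ ayE] := hay.
have : (a i, y) \in codom ay.
  by rewrite ayE inE/= yi andbT; apply/existsP; exists i.
by move=> /codomP[l ->]; exists l.
Qed.

Lemma choice_prob_measurable i y :
  measurable_fun [set: B] (fun b => s b (a i) y).
Proof.
have [yi|yi] := boolP (y \in val (a i)).
  have [l lE] := ordering_onto yi.
  by have := htm l; rewrite /tbar lE.
have [_ _ s0 _] := hs.
have -> : (fun b => s b (a i) y) = cst 0 by apply/funext => b; rewrite s0.
exact: measurable_cst.
Qed.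

Lemma choice_prob_integrable (Q : probability B R) i y :
  Q.-integrable setT (EFin \o (fun b => s b (a i) y)).
Proof.
have [s01 _ _ _] := hs.
by apply: bounded01_integrable => //; exact: choice_prob_measurable.
Qed.

Lemma sum_choice_prob (Q : probability B R) i :
  \sum_(y in val (a i)) \int[Q]_b s b (a i) y = 1.
Proof.
rewrite -Rintegral_sum; last by move=> y; exact: choice_prob_integrable.
have [_ _ _ s1] := hs.
under eq_Rintegral => b _ do rewrite s1.
rewrite Rintegral_cst//.
have -> : fine (Q setT) = 1 by rewrite probability_setT.
by rewrite mulr1.
Qed.

Lemma choice_prob_itv (Q : probability B R) i y :
  0 <= \int[Q]_b s b (a i) y <= 1.
Proof.
have [s01 _ s0 _] := hs.
have ge0 x : 0 <= \int[Q]_b s b (a i) x.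
  by apply: Rintegral_ge0 => b _; have /andP[] := s01 b (a i) x.
rewrite ge0/=; have [yi|yi] := boolP (y \in val (a i)).
  rewrite -(sum_choice_prob Q i) (bigD1 y)//= lerDl.
  by apply: sumr_ge0 => x _; exact: ge0.
under eq_Rintegral => b _ do rewrite s0//.
by rewrite Rintegral_cst// mul0r.
Qed.

Lemma law_sum (Q : probability B R) : \sum_(z in profiles a) law Q z = 1.
Proof. exact: product_law_sum (sum_choice_prob Q). Qed.

Lemma law_itv (Q : probability B R) z : 0 <= law Q z <= 1.
Proof.
apply/andP; split.
  by apply: prodr_ge0 => i _; have /andP[] := choice_prob_itv Q i (z i).
by apply: prodr_ile1 => i _; exact: choice_prob_itv.
Qed.

Lemma menu_count_gt0 l : (0 < menu_count a (ay l).1)%N.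
Proof.
have [[i ai] _] := ordering_mem l.
by rewrite card_gt0; apply/set0Pn; exists i; rewrite inE ai.
Qed.

(** Coordinates facing the same menu have the same outcome marginal, so averaging over them changes
    nothing. *)
Lemma bbar_law (Q : probability B R) l :
  bbar ay (law Q) l = \int[Q]_b tbar s ay l b.
Proof.
have [_ yl] := ordering_mem l.
rewrite /bbar (eq_bigr (fun=> \int[Q]_b tbar s ay l b)); last first.
  move=> i /eqP ai; rewrite /coord_marginal.
  have yi : (ay l).2 \in val (a i) by rewrite ai.
  transitivity (\int[Q]_b s b (a i) (ay l).2); last by rewrite ai.
  exact: (product_law_marginal (sum_choice_prob Q) yi).
rewrite sumr_const -[X in _ * X]mulr_natl mulrA.
have -> : #|(fun i => a i == (ay l).1)| = menu_count a (ay l).1.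
  by rewrite /menu_count; apply: eq_card => i; rewrite inE.
by rewrite mulVf ?mul1r// pnatr_eq0 -lt0n menu_count_gt0.
Qed.

(** A coordinate marginal sums [P] over some of the profiles, so it moves by at most the l1
    distance, and so does an average of such marginals. *)
Lemma dist_bbar_le (P P' : profile J T N -> R) l :
  `|bbar ay P l - bbar ay P' l| <= \sum_(z in profiles a) `|P z - P' z|.
Proof.
rewrite /bbar -mulrBr -sumrB normrM normfV normr_nat.
rewrite ler_pdivrMl ?ltr0n ?menu_count_gt0//.
apply: le_trans (ler_norm_sum _ _ _) _.
apply: (@le_trans _ _ (\sum_(i | a i == (ay l).1)
    \sum_(z in profiles a) `|P z - P' z|)).
  apply: ler_sum => i _; rewrite /coord_marginal -sumrB.
  apply: le_trans (ler_norm_sum _ _ _) _.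
  rewrite [leRHS](bigID (fun z : profile J T N => z i == (ay l).2))/=.
  by rewrite lerDl sumr_ge0.
rewrite sumr_const -[leLHS]mulr_natl.
have -> : #|(fun i => a i == (ay l).1)| = menu_count a (ay l).1.
  by rewrite /menu_count; apply: eq_card => i; rewrite inE.
by [].
Qed.

Definition entropy (P : profile J T N -> R) : R :=
  - \sum_(z in profiles a) P z * ln (P z).

Lemma nonparametric_itv (P : profile J T N -> R) z :
  nonparametric_model a P -> 0 <= P z <= 1.
Proof.
move=> [P0 Pout P1]; rewrite P0/=.
have [zp|zp] := boolP (z \in profiles a); last by rewrite Pout.
by rewrite -P1 (bigD1 z)//= lerDl sumr_ge0.
Qed.

(** The scalar bounds are summed over profiles; their linear terms cancel because [P] and the law
    both have total mass [1]. *)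
Lemma risk_ge (P : profile J T N -> R) (Q : probability B R) :
  nonparametric_model a P ->
  ((entropy P + \sum_(z in profiles a) (P z - law Q z) ^+ 2 / 4)%:E
     <= risk a s P Q)%E.
Proof.
move=> hP; rewrite /risk leeNr -EFinN.
apply: (@le_trans _ _ (\sum_(z in profiles a)
   (P z * ln (P z) + law Q z - P z - (P z - law Q z) ^+ 2 / 4)%:E)%E).
  apply: lee_sum => z _; apply: mul_lne_le; last exact: law_itv.
  exact: nonparametric_itv.
rewrite sumEFin lee_fin !sumrB big_split/= law_sum /entropy.
by have [_ _ ->] := hP; lra.
Qed.

Lemma risk_realized (P : profile J T N -> R) (Q : probability B R) :
  nonparametric_model a P -> (forall z, z \in profiles a -> P z = law Q z) ->
  risk a s P Q = (entropy P)%:E.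
Proof.
move=> [P0 _ _] PQ; rewrite /risk /entropy EFinN -sumEFin; congr (- _)%E.
apply: eq_bigr => z zp; rewrite -PQ//.
have [->|Pn0] := eqVneq (P z) 0; first by rewrite mul0e mul0r.
by rewrite lne_EFin// lt_neqAle eq_sym Pn0 P0.
Qed.

(** On a profile every factor of the law is the integral of some [tbar l], since the ordering
    reaches all pairs of a design menu and an outcome in it. *)
Lemma law_eq_of_moments (Q Q' : probability B R) :
  (forall l, \int[Q]_b tbar s ay l b = \int[Q']_b tbar s ay l b) ->
  forall z, z \in profiles a -> law Q z = law Q' z.
Proof.
move=> QQ' z; rewrite inE => /forallP za; apply: eq_bigr => i _.
by have [l lE] := ordering_onto (za i); have := QQ' l; rewrite /tbar lE.
Qed.

(** The weight of a menu is its share among the [N] coordinates. Expanding it over these coordinates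
    and exchanging sums leaves, for each [i], the choice probabilities on [a i], which sum to
    [1]. *)
Lemma sum_eweight_tbar b : (0 < N)%N ->
  \sum_l eweight R ay l * tbar s ay l b = 1.
Proof.
move=> N0; have [ayI ayE] := hay; have [_ _ _ s1] := hs.
transitivity (\sum_(p in menu_outcomes a)
    (menu_count a p.1)%:R / N%:R * s b p.1 p.2).
  rewrite (eq_bigl (mem (ay @: [set: 'I_#|menu_outcomes a|])%SET)); last first.
    move=> p; rewrite -ayE; apply/codomP/imsetP => [[l ->]|[l _ ->]];
      by exists l.
  rewrite big_imset/=; last by move=> ? ? _ _; exact: ayI.
  by apply: eq_bigl => l; rewrite inE.
transitivity (\sum_(p in menu_outcomes a) \sum_(i | a i == p.1)
    N%:R^-1 * s b p.1 p.2).
  apply: eq_bigr => p _; rewrite sumr_const -[RHS]mulr_natl mulrA.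
  congr (_ * _ * _).
  by congr (_%:R); rewrite /menu_count; apply: eq_card => i; rewrite inE.
rewrite (exchange_big_dep predT)//=.
transitivity (\sum_(i < N) (N%:R^-1 : R)); last first.
  by rewrite sumr_const card_ord -[LHS]mulr_natl divff// pnatr_eq0 -lt0n.
apply: eq_bigr => i _; rewrite -[RHS]mulr1 -(s1 b (a i)) mulr_sumr.
rewrite (eq_bigl (mem [set (a i, y) | y in val (a i)]%SET)); last first.
  move=> p /=; apply/andP/imsetP => [[pD /eqP ai]|[y yi ->]].
    move: pD; rewrite inE => /andP[_ yp]; exists p.2; first by rewrite ai.
    by rewrite ai -surjective_pairing.
  by rewrite inE/= yi eqxx; split=> //; rewrite andbT; apply/existsP; exists i.
by rewrite big_imset//= => ? ? _ _ [].
Qed.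

End Model.

(** * Mixtures, couplings and the divergence *)

Section Mixtures.
Variables (R : realType) (J T N : nat) (d : measure_display).
Variable B : measurableType d.
Variables (a : 'I_N -> menu J T) (s : B -> menu J T -> outcome J T -> R).
Variable g : B -> R.
Variable ay : 'I_#|menu_outcomes a| -> menu J T * outcome J T.
Hypothesis N0 : (0 < N)%N.
Hypothesis hs : choice_kernel s.
Hypothesis hg01 : forall b, 0 <= g b <= 1.
Hypothesis hay : is_ordering ay.

Lemma sum_gamma b : \sum_(m < 2) gamma g m b = 1.
Proof. by rewrite !big_ord_recl big_ord0 /gamma /= addr0 addrC subrK. Qed.

Section FixedMixture.
Variables (K : nat) (w : 'I_K -> R) (b : 'I_K -> B).
Local Notation q := (mixture s g ay w b).

Lemma mixture_marginal_moment l :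
  \sum_(k < K) \sum_(m < 2) q (k, l, m) =
  eweight R ay l * \sum_k w k * tbar s ay l (b k).
Proof.
rewrite mulr_sumr; apply: eq_bigr => k _.
rewrite /mixture -mulr_sumr sum_gamma mulr1; ring.
Qed.

Lemma mixture_marginal_gamma m :
  \sum_(k < K) \sum_l q (k, l, m) = \sum_k w k * gamma g m (b k).
Proof.
apply: eq_bigr => k _; rewrite /mixture -mulr_suml; congr (_ * _).
under eq_bigr => l _ do rewrite -mulrA.
by rewrite -mulr_sumr sum_eweight_tbar// mulr1.
Qed.

Lemma sum_triple (F : 'I_K * 'I_#|menu_outcomes a| * 'I_2 -> R) :
  \sum_x F x = \sum_m \sum_k \sum_l F (k, l, m).
Proof.
rewrite exchange_big/=.
under [RHS]eq_bigr => k _ do rewrite exchange_big/=.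
rewrite pair_big/= pair_big/=.
by apply: eq_bigr => -[[k l] m].
Qed.

Lemma mixture_simplex : simplex w -> simplex q.
Proof.
move=> [w01 w1].
have q0 x : 0 <= q x.
  case: x => [[k l] m]; rewrite /mixture.
  have [s01 _ _ _] := hs.
  have /andP[wk0 _] := w01 k.
  have /andP[t0 _] := s01 (b k) (ay l).1 (ay l).2.
  have /andP[g0 g1] := hg01 (b k).
  rewrite !mulr_ge0 ?invr_ge0//; rewrite /gamma; case: ifP => // _.
  by rewrite subr_ge0.
have q1 : \sum_x q x = 1.
  rewrite sum_triple; under eq_bigr => m _ do rewrite mixture_marginal_gamma.
  rewrite exchange_big/= -w1; apply: eq_bigr => k _.
  by rewrite -mulr_sumr sum_gamma mulr1.
split=> // x; rewrite q0/= -q1 (bigD1 x)//= lerDl.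
by apply: sumr_ge0 => y _.
Qed.

(** Exact moments make the mixture admissible as its own coupling, at zero divergence. *)
Lemma mixture_coupling (P : profile J T N -> R) psi : simplex w ->
  (forall l, \sum_k w k * tbar s ay l (b k) = bbar ay P l) ->
  \sum_k w k * g (b k) = psi ->
  couplings ay P psi q.
Proof.
move=> hw wt wg; split; first exact: mixture_simplex.
  by move=> l; rewrite mixture_marginal_moment wt.
move=> m; rewrite mixture_marginal_gamma /gamma /varpi; case: eqP => // _.
under eq_bigr => k _ do rewrite mulrBr mulr1.
by have [_ w1] := hw; rewrite sumrB w1 wg.
Qed.

(** The marginals of [r] are prescribed and those of [q] are mixture moments, so both errors come
    from marginals of [q - r]. *)
Lemma coupling_close (P : profile J T N -> R) psi r :
  couplings ay P psi r ->
  (forall l, `|\sum_k w k * tbar s ay l (b k) - bbar ay P l|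
     <= N%:R * \sum_x `|r x - q x|) /\
  `|\sum_k w k * g (b k) - psi| <= \sum_x `|r x - q x|.
Proof.
move=> [_ rl rm]; split=> [l|].
  (* Every listed menu occurs in the design, so its weight is at least [1 / N]; dividing by it costs
     the factor [N]. *)
  have e0 : N%:R^-1 <= eweight R ay l.
    rewrite /eweight -[leLHS]mul1r ler_wpM2r ?invr_ge0// ler1n.
    exact: menu_count_gt0.
  have N0' : 0 < N%:R :> R by rewrite ltr0n.
  set D := \sum_k _ - _.
  have DE : eweight R ay l * D = \sum_k \sum_m (q (k, l, m) - r (k, l, m)).
    rewrite mulrBr -mixture_marginal_moment -[_ * bbar _ _ _]rl -sumrB.
    by apply: eq_bigr => k _; rewrite -sumrB.
  have : `|eweight R ay l * D| <= \sum_x `|r x - q x|.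
    rewrite DE; apply: le_trans (ler_norm_sum _ _ _) _.
    rewrite sum_triple exchange_big/=; apply: ler_sum => k _.
    apply: le_trans (ler_norm_sum _ _ _) _; apply: ler_sum => m _.
    by rewrite (bigD1 l)//= distrC lerDl sumr_ge0.
  rewrite normrM ger0_norm ?(le_trans _ e0) ?invr_ge0//.
  move=> H; rewrite -ler_pdivrMl//; apply: le_trans H.
  by rewrite ler_wpM2r.
have -> : \sum_k w k * g (b k) - psi =
    \sum_k \sum_l (q (k, l, ord0) - r (k, l, ord0)).
  have -> : psi = varpi psi ord0 by [].
  rewrite -rm -[X in X - _](mixture_marginal_gamma ord0) -sumrB.
  by apply: eq_bigr => k _; rewrite -sumrB.
apply: le_trans (ler_norm_sum _ _ _) _.
rewrite sum_triple (bigD1 ord0)//=; apply: ler_wpDr.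
  by do 3![apply: sumr_ge0 => ? _].
apply: ler_sum => k _; apply: le_trans (ler_norm_sum _ _ _) _.
by apply: ler_sum => l _; rewrite distrC.
Qed.

End FixedMixture.

Lemma KL_refl (I : finType) (q : I -> R) : KL q q = 0%E.
Proof.
rewrite /KL big1// => i _; case: eqVneq => // qi.
by rewrite divff// ln1 mulr0.
Qed.

Lemma divergence_ge0 K (P : profile J T N -> R) psi :
  (0 <= divergence s g ay K P psi)%E.
Proof.
apply: le_ereal_inf_tmp => _ [wb hw <-].
apply: le_ereal_inf_tmp => _ [r [hr _ _] <-].
apply: le_trans (KL_ge hr (mixture_simplex _ hw)).
by rewrite lee_fin sumr_ge0// => x _; rewrite divr_ge0// sqr_ge0.
Qed.

Lemma divergence_eq0 K (P : profile J T N -> R) psi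
    (w : 'I_K -> R) (b : 'I_K -> B) : simplex w ->
  (forall l, \sum_k w k * tbar s ay l (b k) = bbar ay P l) ->
  \sum_k w k * g (b k) = psi ->
  divergence s g ay K P psi = 0%E.
Proof.
move=> hw wt wg; apply/eqP; rewrite eq_le divergence_ge0 andbT.
apply: le_trans (ereal_inf_lbound _) _.
  by exists (w, b); [exact: hw|reflexivity].
rewrite /= -(KL_refl (mixture s g ay w b)); apply: ereal_inf_lbound.
by exists (mixture s g ay w b) => //; exact: mixture_coupling.
Qed.

Lemma divergence_eq0_approx K (P : profile J T N -> R) psi (e : R) :
  divergence s g ay K P psi = 0%E -> 0 < e ->
  exists (w : 'I_K -> R) (b : 'I_K -> B), [/\ simplex w,
    forall l, `|\sum_k w k * tbar s ay l (b k) - bbar ay P l| < e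
    & `|\sum_k w k * g (b k) - psi| < e].
Proof.
move=> D0 e0.
have eN0 : 0 < e / N%:R by rewrite divr_gt0// ltr0n.
(* A divergence below [D] forces [r] and the mixture to be [e / N]-close in l1, which absorbs the
   factor [N] of [coupling_close]. *)
have [D Dpos DH] :=
  sqr_dist_l1_small (I := ('I_K * 'I_#|menu_outcomes a| * 'I_2)%type) predT eN0.
have : (divergence s g ay K P psi < D%:E)%E by rewrite D0 lte_fin.
move=> /ereal_inf_lt[_ [[w b] /= hw <-]] /ereal_inf_lt[_ [r hr <-]] KLD.
have l1 : \sum_x `|r x - mixture s g ay w b x| < e / N%:R.
  apply: DH; rewrite -lte_fin; apply: le_lt_trans KLD.
  by have [hr' _ _] := hr; apply: KL_ge => //; exact: mixture_simplex.
have [wt wg] := coupling_close w b hr.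
exists w, b; split=> // [l|].
  apply: le_lt_trans (wt l) _.
  by rewrite mulrC -ltr_pdivlMr// ltr0n.
apply: le_lt_trans wg _; apply: lt_le_trans l1 _.
by rewrite ler_pdivrMr ?ltr0n// ler_peMr ?ler1n// ltW.
Qed.

End Mixtures.

(** * Representation of moments and effect by few points *)

Section Representation.
Variables (R : realType) (J T N : nat) (a : 'I_N -> menu J T).
Variable B : pointedMetricType R.
Variables (s : borel B -> menu J T -> outcome J T -> R) (g : borel B -> R).
Variable ay : 'I_#|menu_outcomes a| -> menu J T * outcome J T.
Hypothesis hB : compact [set: B].
Hypothesis hgcont : continuous (g : B -> R).
Hypothesis htcont : forall l, continuous (tbar s ay l : B -> R).
Hypothesis hg01 : forall b, 0 <= g b <= 1.
Hypothesis hs : choice_kernel s.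

(** The outer [None] is the effect, so that removing it leaves the family whose independence defines
    [Ltilde]; [Some None] is the constant [1], which records total mass. *)
Definition effect_moment_family (i : option (option 'I_#|menu_outcomes a|))
    (b : borel B) : R :=
  if i is Some o then moment_family s ay o b else g b.

Definition effect_moment_target (tau : 'I_#|menu_outcomes a| -> R) (psi : R)
    (i : option (option 'I_#|menu_outcomes a|)) : R :=
  match i with
  | Some (Some l) => tau l
  | Some None => 1
  | None => psi
  end.

Lemma effect_moment_continuous i :
  continuous (effect_moment_family i : B -> R).
Proof.
case: i => [[l|]|]; [exact: htcont| |exact: hgcont].
by move=> x; apply: cvg_cst.
Qed.

Lemma effect_moment_itv i b : 0 <= effect_moment_family i b <= 1.
Proof.
case: i => [[l|]|] //=; last by rewrite ler01 lexx.
by have [s01 _ _ _] := hs; exact: s01.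
Qed.

Lemma effect_moment_rank n (b : 'I_n -> borel B) :
  (\rank (\matrix_(k < n, i < #|{: option (option 'I_#|menu_outcomes a|)}|)
     effect_moment_family (enum_val i) (b k)) <= Ltilde s ay + 2)%N.
Proof.
rewrite addn2; apply: rank_le_independent => S indS.
(* [Ltilde] is a truncated predecessor, so the maximal cardinality is at most [Ltilde + 1]; the
   effect accounts for the other unit. *)
apply: leq_trans (leqSpred _).
apply: (@leq_bigmax_cond _ (fun S => `[< linearly_independent s ay S >])
  (fun S : {set option 'I_#|menu_outcomes a|} => #|S|)).
exact/asboolP.
Qed.

(** The approximating weights need only lie in [[0, 1]]; the exact moment of the constant [1] puts
    the limit on the simplex. *)
Lemma representation_attained K tau psi :
  (forall e : R, 0 < e -> exists (w : 'I_K -> R) (b : 'I_K -> borel B),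
     (forall k, 0 <= w k <= 1) /\
     forall i, `|\sum_k w k * effect_moment_family i (b k)
                 - effect_moment_target tau psi i| < e) ->
  exists (w : 'I_K -> R) (b : 'I_K -> borel B), [/\ simplex w,
    forall l, \sum_k w k * tbar s ay l (b k) = tau l
    & \sum_k w k * g (b k) = psi].
Proof.
move=> /(mixture_moments_attained hB effect_moment_continuous)[w [b [w01 wE]]].
exists w, b; split=> [|l|].
- split=> //; have := wE (Some None); rewrite /= => <-.
  by apply: eq_bigr => k _; rewrite mulr1.
- exact: wE (Some (Some l)).
- exact: wE None.
Qed.

Lemma representation_of_approximations tau psi :
  (forall e : R, 0 < e -> exists Q : probability (borel B) R,
     Psi_tilde g Q = psi /\
     forall l, `|\int[Q]_b tbar s ay l b - tau l| < e) ->
  exists (w : 'I_(Ltilde s ay + 2) -> R) (b : 'I_(Ltilde s ay + 2) -> borel B),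
    [/\ simplex w,
    forall l, \sum_k w k * tbar s ay l (b k) = tau l
    & \sum_k w k * g (b k) = psi].
Proof.
move=> approx; apply: representation_attained => e e0.
(* One half is for the moment error of [Q], the other for replacing [Q] by a finite mixture; the
   Caratheodory reduction costs nothing. *)
have e20 : 0 < e / 2 by rewrite divr_gt0.
have [Q [Qg Qt]] := approx _ e20.
have mF i : measurable_fun setT (effect_moment_family i).
  by apply: continuous_borel_measurable; exact: effect_moment_continuous.
have [n [w [b [w0 w1 wF]]]] :=
  integral_approx_mixture Q mF effect_moment_itv e20.
have [w' [b' [w'0 w'F]]] := conic_caratheodory effect_moment_rank b w0.
(* The reduction keeps the moment of the constant [1], hence the total mass. *)
have w'1 : \sum_k w' k = 1.
  transitivity (\sum_k w' k * effect_moment_family (Some None) (b' k)).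
    by apply: eq_bigr => k _; rewrite mulr1.
  by rewrite w'F -[RHS]w1; apply: eq_bigr => k _; rewrite mulr1.
exists w', b'; split=> [k|i].
  by rewrite w'0 -w'1 (bigD1 k)//= lerDl sumr_ge0.
rewrite w'F.
have Fe : `|\int[Q]_x effect_moment_family i x - effect_moment_target tau psi i|
    < e / 2.
  case: i => [[l|]|] /=.
  - exact: Qt.
  - rewrite Rintegral_cst//.
    have -> : fine (Q setT) = 1 by rewrite probability_setT.
    by rewrite mulr1 subrr normr0.
  - by rewrite -Qg subrr normr0.
rewrite [e]splitr; apply: le_lt_trans (ltrD (wF i) Fe).
exact: ler_distD.
Qed.

End Representation.

(** * Vanishing divergence and maximum likelihood *)

Theorem proposition2 (R : realType) (J T N : nat)
  (hJ : (1 <= J)%N) (hT : (1 <= T)%N) (hN : (1 <= N)%N)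
  (a : 'I_N -> menu J T)
  (B : pointedMetricType R) (hB : compact [set: B])
  (s : borel B -> menu J T -> outcome J T -> R) (hs : choice_kernel s)
  (g : borel B -> R) (hg : measurable_fun [set: borel B] g)
  (hg01 : forall b, 0 <= g b <= 1)
  (ay : 'I_#|menu_outcomes a| -> menu J T * outcome J T)
  (hay : is_ordering ay)
  (hgcont : continuous (g : B -> R))
  (htcont : forall l, continuous (tbar s ay l : B -> R))
  (P : profile J T N -> R) (hP : nonparametric_model a P)
  (hreal : realizable a s P)
  (psi : R) (hpsi : 0 <= psi <= 1) :
  (exists K : nat,
     [/\ (0 < K)%N, (K <= Ltilde s ay + 2)%N
       & divergence s g ay K P psi = 0%E])
  <-> Psi_mle a s g P psi.
Proof.
have htm l : measurable_fun [set: borel B] (tbar s ay l).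
  exact: continuous_borel_measurable.
have [Q0 PQ0] := hreal.
(* [P] and the law of [Q0] agree on profiles, so their l1 distance there is zero. *)
have bbarE l : bbar ay P l = \int[Q0]_b tbar s ay l b.
  rewrite -(bbar_law hs hay htm); apply/eqP; rewrite -subr_eq0 -normr_le0.
  apply: le_trans (dist_bbar_le hay _ _ _) _.
  by rewrite big1// => z zp; rewrite PQ0// subrr normr0.
split=> [[K [K0 _ D0]]|[_ PLmin]].
  have [w [b [hw wt wg]]] : exists (w : 'I_K -> R) (b : 'I_K -> borel B),
      [/\ simplex w, forall l, \sum_k w k * tbar s ay l (b k) = bbar ay P l
       & \sum_k w k * g (b k) = psi].
    apply: representation_attained => // e e0.
    have [w [b [hw wt wg]]] :=
      divergence_eq0_approx hN hs hg01 hay D0 e0.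
    exists w, b; split; first by case: hw.
    case=> [[l|]|] //=.
    under eq_bigr => k _ do rewrite mulr1.
    by case: hw => _ ->; rewrite subrr normr0.
  have [w01 w1] := hw.
  (* Read as a law [Q], the mixture has effect [psi] and outcome marginal [P], so its risk is the
     entropy, a lower bound for every risk. *)
  have [|Q QE] := mixture_probability (w := w) b _ w1.
    by move=> k; have /andP[] := w01 k.
  have PQ z : z \in profiles a -> P z = outcome_marginal (full_law a s Q) z.
    move=> zp; rewrite PQ0//; apply: (law_eq_of_moments hay) => // l.
    rewrite -bbarE -wt QE// => x.
    by have [s01 _ _ _] := hs; have /andP[] := s01 x (ay l).1 (ay l).2.
  split=> // psi' _.
  apply: (@le_trans _ _ (entropy a P)%:E).
    apply: ereal_inf_lbound; exists Q; last exact: risk_realized.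
    by rewrite /= /Psi_tilde QE// => x; have /andP[] := hg01 x.
  apply: le_ereal_inf_tmp => _ [Q' _ <-].
  apply: le_trans (risk_ge hs hay htm Q' hP).
  by rewrite lee_fin lerDl sumr_ge0// => z _; rewrite divr_ge0// sqr_ge0.
exists (Ltilde s ay + 2)%N; split=> //; first by rewrite addn2.
have [w [b [hw wt wg]]] : exists (w : 'I_(Ltilde s ay + 2) -> R)
    (b : 'I_(Ltilde s ay + 2) -> borel B), [/\ simplex w,
    forall l, \sum_k w k * tbar s ay l (b k) = bbar ay P l
    & \sum_k w k * g (b k) = psi].
  apply: representation_of_approximations => // e e0.
  have [D Dpos DH] := sqr_dist_l1_small (mem (profiles a)) e0.
  have gi : Q0.-integrable setT (EFin \o g) by exact: bounded01_integrable.
  (* The effect of the realizing law is then an admissible competitor of [psi]. *)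
  have g01 : 0 <= Psi_tilde g Q0 <= 1.
    apply/andP; split.
      by apply: Rintegral_ge0 => x _; have /andP[] := hg01 x.
    apply: (@le_trans _ _ (\int[Q0]_(x in setT) (1 : R))).
      apply: le_Rintegral => //; last by move=> x _; have /andP[] := hg01 x.
      exact: finite_measure_integrable_cst.
    rewrite Rintegral_cst//.
    have -> : fine (Q0 setT) = 1 by rewrite probability_setT.
    by rewrite mulr1.
  (* Minimality at [psi] against the effect of [Q0], whose risk is the entropy, yields laws with
     effect [psi] and excess risk below [D]. *)
  have : (profile_likelihood a s g P psi < (entropy a P + D)%:E)%E.
    apply: le_lt_trans (PLmin _ g01) _.
    apply: (@le_lt_trans _ _ (entropy a P)%:E); last by rewrite lte_fin ltrDl.
    by apply: ereal_inf_lbound; exists Q0 => //; exact: risk_realized.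
  move=> /ereal_inf_lt[_ [Q Qpsi <-]] risklt.
  exists Q; split=> // l; rewrite -(bbar_law hs hay htm) distrC.
  apply: le_lt_trans (dist_bbar_le hay _ _ _) _; apply: DH.
  (* By [risk_ge] the excess risk dominates the squared distance, which is thus below [D]. *)
  rewrite -(ltrD2l (entropy a P)) -lte_fin.
  exact: le_lt_trans (risk_ge hs hay htm Q hP) risklt.
exact: divergence_eq0 hw wt wg.
Qed.
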